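(* For $\alpha>0$ and $\sigma>0$, let $X_{\alpha,\sigma}$ denote a log-normal random variable with probability density function $$f_{\alpha,\sigma}(x)=\frac{1}{\sigma x\sqrt{2\pi}}e^{-\frac{(\ln x-\alpha)^2}{2\sigma^2}},\qquad x>0.$$ Then for every real $y>0$, $$\inf_{\alpha>0,\,\sigma>0}\mathbf{P}\left(|X_{\alpha,\sigma}-\mathbf{E}[X_{\alpha,\sigma}]|\ge y\sqrt{\mathrm{Var}(X_{\alpha,\sigma})}\right)=0.$$
   Context: $\mathbf{P}$, $\mathbf{E}$ and $\mathrm{Var}$ denote probability, expectation and variance. The density is $0$ outside the indicated range. *)

(* Defs.v *)
From HB Require Import structures.
From mathcomp Require Import all_boot all_order all_algebra.
From mathcomp Require Import all_classical all_reals all_analysis.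

Set Implicit Arguments.
Unset Strict Implicit.
Unset Printing Implicit Defensive.

Import Order.TTheory GRing.Theory Num.Theory.
Import numFieldNormedType.Exports.

Local Open Scope classical_set_scope.
Local Open Scope ring_scope.

Definition lognormal_pdf {R : realType} (a s x : R) : R :=
  if 0 < x then
    (s * x * Num.sqrt (2 * pi))^-1 * expR (- ((ln x - a) ^+ 2 / (2 * s ^+ 2)))
  else 0.

Definition has_density {d : measure_display} {T : measurableType d}
    {R : realType} (P : probability T R) (X : {RV P >-> R}) (f : R -> R) : Prop :=
  forall A : set R, measurable A ->
    distribution P X A = (\int[lebesgue_measure]_(x in A) (f x)%:E)%E.

(* Main.v *)
Require Import Defs.
From HB Require Import structures.
From mathcomp Require Import all_boot all_order all_algebra.
From mathcomp Require Import all_classical all_reals all_analysis.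
From mathcomp Require Import measurable_realfun ring lra.

Set Implicit Arguments.
Unset Strict Implicit.
Unset Printing Implicit Defensive.

Import Order.TTheory GRing.Theory Num.Theory.
Import numFieldNormedType.Exports.

Local Open Scope classical_set_scope.
Local Open Scope ring_scope.

(** The standard deviation of a log-normal variable becomes arbitrarily large
compared with its mean as [s] grows, so a deviation of [y] standard deviations
from the mean becomes a very large multiple of the mean, and the Markov
inequality makes it unlikely.

In detail, fix the first parameter at 1.  With [m = E|X|], the moments satisfy
[E[X^2] = m^2 * exp (s^2)], hence [Var X >= m^2 * K^2] where
[K^2 = exp (s^2) - 1].  If [|X - E[X]| >= y * sqrt (Var X)] then
[|X| >= y * K * m - m], since [|E[X]| <= m]; the Markov inequality for [|X|]
bounds the probability of this event by [1 / (y * K - 1)]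
([prob_deviation_le]), which tends to 0 as [s], and with it [K], goes to
infinity.

No integral is computed to get the moments.  Multiplying the log-normal density
by [x^k] gives, after completing the square in the exponent, a constant times
the log-normal density with first parameter shifted by [k * s^2]
([normrX_lognormal_pdf]).  That density is again the density of a random
variable, so it has total mass 1 and the constant is the moment
([lognormal_moment]). *)

Lemma lognormal_pdf_ge0 {R : realType} (a s x : R) :
  0 <= s -> 0 <= lognormal_pdf a s x.
Proof.
rewrite /lognormal_pdf => s0; case: ifPn => // x0.
by rewrite mulr_ge0 ?expR_ge0// invr_ge0 !mulr_ge0// ltW.
Qed.

Lemma measurable_lognormal_pdf {R : realType} (a s : R) :
  measurable_fun [set: R] (lognormal_pdf a s).
Proof.
have -> : lognormal_pdf a s = fun x => if 0 < x then
    (s * Num.sqrt (2 * pi))^-1 *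
      expR (- ((ln x - a) ^+ 2 / (2 * s ^+ 2)) - ln x) else 0.
  apply/funext => x; rewrite /lognormal_pdf; case: ifPn => // x0.
  (* Absorbing the factor [1 / x] into the exponential removes the inverse. *)
  rewrite expRB lnK ?posrE// mulrAC !invfM.
  by ring.
apply: measurable_fun_ifT => //; first exact: measurable_fun_ltr.
apply: measurable_funM => //; apply: measurableT_comp => //.
have mln : measurable_fun [set: R] (@ln R) by exact: measurable_ln.
apply: measurable_funB => //; apply: measurableT_comp => //.
by apply: measurable_funM => //; apply: measurable_funX; exact: measurable_funB.
Qed.

(** Completing the square: with [L = ln x], the exponent
[k * L - (L - a)^2 / (2 * s^2)] is a quadratic in [L] with the same leading
coefficient and with vertex [a + k * s^2]. *)
Lemma normrX_lognormal_pdf {R : realType} (a s x : R) (k : nat) : 0 < s ->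
  `|x| ^+ k * lognormal_pdf a s x =
  expR (k%:R * a + k%:R ^+ 2 * s ^+ 2 / 2) *
    lognormal_pdf (a + k%:R * s ^+ 2) s x.
Proof.
rewrite /lognormal_pdf => s0; case: ifPn => [x0|_]; last by rewrite !mulr0.
rewrite gtr0_norm// mulrCA [RHS]mulrCA; congr (_ * _).
rewrite -{1}(lnK x0) -expRM_natl -!expRD; congr expR.
by field; rewrite gt_eqF.
Qed.

(** The Lebesgue measure lives on [measurableTypeR R], which has the same
measurable sets as [R] but another display; this lemma moves measurability from
one to the other. *)
Lemma measurable_EFin_lebesgue {R : realType} (h : R -> R)
    (A : set (measurableTypeR R)) :
  measurable_fun [set: R] h -> measurable_fun A (EFin \o h).
Proof.
move=> mh; apply/measurable_EFinP/measurable_funTS => mT Y mY.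
exact: mh.
Qed.

(** The law of [X] is dominated by the Lebesgue measure, and its Radon-Nikodym
derivative agrees almost everywhere with the density [f], because both have the
same integral over every measurable set. *)
Lemma integral_comp_density {d : measure_display} {T : measurableType d}
    {R : realType} (P : probability T R) (X : {RV P >-> R}) (f g : R -> R) :
  has_density X f ->
  measurable_fun [set: R] f ->
  measurable_fun [set: R] g -> (forall x, 0 <= g x) ->
  (\int[P]_w (g (X w))%:E = \int[lebesgue_measure]_x (g x * f x)%:E)%E.
Proof.
move=> Xf mf mg g0.
(* The same variable, seen with values in [measurableTypeR R]. *)
have mX : measurable_fun [set: T] (X : T -> measurableTypeR R).
  by move=> mT Y mY; exact: (@measurable_funPT _ _ _ _ X mT Y mY).
pose X' : {mfun T >-> measurableTypeR R} :=
  HB.pack (X : T -> measurableTypeR R)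
    (isMeasurableFun.Build _ _ _ _ (X : T -> measurableTypeR R) mX).
pose D : {finite_measure set (measurableTypeR R) -> \bar R} :=
  distribution P X'.
have DE A : measurable A -> D A = (\int[lebesgue_measure]_(x in A) (f x)%:E)%E.
  exact: Xf.
have dom : D `<< (@lebesgue_measure R).
  apply/null_content_dominatesP => A mA A0.
  by rewrite DE// null_set_integral//; exact: measurable_EFin_lebesgue.
have -> : (\int[P]_w (g (X w))%:E = \int[D]_x (g x)%:E)%E.
  rewrite (@ge0_integral_distribution _ _ _ _ _ P X' (EFin \o g))//.
  exact: measurable_EFin_lebesgue.
have mrn : measurable_fun [set: measurableTypeR R]
    (Radon_Nikodym_SigmaFinite.f D (@lebesgue_measure R)).
  exact: measurable_int (Radon_Nikodym_SigmaFinite.f_integrable dom).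
have rnE : ae_eq lebesgue_measure [set: measurableTypeR R]
    (Radon_Nikodym_SigmaFinite.f D (@lebesgue_measure R)) (EFin \o f).
  apply: integral_ae_eq => //.
  - exact: Radon_Nikodym_SigmaFinite.f_integrable.
  - exact: measurable_EFin_lebesgue.
  - by move=> A _ mA; rewrite -Radon_Nikodym_SigmaFinite.f_integral// DE.
rewrite -(Radon_Nikodym_SigmaFinite.change_of_variables dom)//; last first.
  exact: measurable_EFin_lebesgue.
apply: ae_eq_integral => //.
- by apply: emeasurable_funM => //; exact: measurable_EFin_lebesgue.
- by apply: measurable_EFin_lebesgue; exact: measurable_funM.
- exact: ae_eqe_mul2l rnE.
Qed.

Lemma density_integral1 {d : measure_display} {T : measurableType d}
    {R : realType} (P : probability T R) (X : {RV P >-> R}) (f : R -> R) :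
  has_density X f -> (\int[lebesgue_measure]_x (f x)%:E = 1)%E.
Proof. by move=> Xf; rewrite -Xf// probability_setT. Qed.

(** The moment is the constant of [normrX_lognormal_pdf] because the shifted
density integrates to 1.  That mass is a hypothesis, which allows the shifted
density to belong to a variable on another probability space. *)
Lemma lognormal_moment {d : measure_display} {T : measurableType d}
    {R : realType} (P : probability T R) (X : {RV P >-> R}) (a s : R)
    (k : nat) : 0 < s ->
  has_density X (lognormal_pdf a s) ->
  (\int[lebesgue_measure]_x (lognormal_pdf (a + k%:R * s ^+ 2) s x)%:E = 1)%E ->
  ('E_P[(fun w => `|X w| ^+ k)%R] =
    (expR (k%:R * a + k%:R ^+ 2 * s ^+ 2 / 2))%:E)%E.
Proof.
move=> s0 Xf mass1; rewrite unlock.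
rewrite (integral_comp_density (g := fun x => `|x| ^+ k) Xf)//.
- under eq_integral do rewrite normrX_lognormal_pdf// EFinM.
  rewrite ge0_integralZl_EFin ?expR_ge0//.
  + by rewrite mass1 mule1.
  + by move=> x _; rewrite lee_fin lognormal_pdf_ge0// ltW.
  + by apply: measurable_EFin_lebesgue; exact: measurable_lognormal_pdf.
- exact: measurable_lognormal_pdf.
- by apply: measurable_funX; exact: normr_measurable.
Qed.

(** Membership in [Lfun P 2] is stated with the real power function of the
norm; this is the form in terms of the natural power. *)
Lemma Lfun2_of_moment2 {d : measure_display} {T : measurableType d}
    {R : realType} (P : probability T R) (X : {RV P >-> R}) :
  ('E_P[(fun w => `|X w| ^+ 2)%R] < +oo)%E -> (X : T -> R) \in Lfun P 2%:E.
Proof.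
rewrite unlock => X2.
rewrite inE; apply/andP; split; rewrite inE/=; first exact: measurable_funPT.
rewrite /finite_norm unlock/=; apply: poweR_lty.
by under eq_integral do rewrite powR_mulrn//.
Qed.

(** Since [|E[X]| <= E|X| = m], the variance is at least
[E[X^2] - m^2 = (m * K)^2].  A deviation of [y] standard deviations then forces
[|X| >= m * (y * K - 1)], to which the Markov inequality applies. *)
Lemma prob_deviation_le {d : measure_display} {T : measurableType d}
    {R : realType} (P : probability T R) (X : {RV P >-> R}) (m K y : R) :
  0 < m -> 0 <= K -> 1 < y * K ->
  ('E_P[(fun w => `|X w|)%R] = m%:E)%E ->
  ('E_P[(fun w => `|X w| ^+ 2)%R] = (m ^+ 2 * (1 + K ^+ 2))%:E)%E ->
  (P [set w | (y * Num.sqrt (fine 'V_P[X]) <= `|X w - fine 'E_P[X]|)%R]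
    <= ((y * K - 1)^-1)%:E)%E.
Proof.
move=> m0 K0 yK EX1 EX2.
have y0 : 0 < y.
  by rewrite ltNge; apply/negP => y0; have := mulr_le0_ge0 y0 K0; lra.
have X2 : (X : T -> R) \in Lfun P 2%:E by rewrite Lfun2_of_moment2// EX2 ltry.
have X1 : (X : T -> R) \in Lfun P 1 by rewrite Lfun_subset12 ?fin_num_measure.
pose M := fine 'E_P[X].
have EM : ('E_P[X] = M%:E)%E by rewrite fineK// expectation_fin_num.
have Mm : `|M| <= m.
  rewrite -lee_fin -EX1 -abse_EFin -EM unlock.
  apply: le_trans (le_abse_integral _ _ _) _ => //.
  exact/measurable_EFinP.
have V : m * K <= Num.sqrt (fine 'V_P[X]).
  rewrite -[leLHS]ger0_norm ?mulr_ge0 ?(ltW m0)// -sqrtr_sqr ler_wsqrtr//.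
  rewrite varianceE// EM.
  have -> : ('E_P[(X ^+ 2)%R] = (m ^+ 2 * (1 + K ^+ 2))%:E)%E.
    rewrite -EX2; congr expectation; apply/funext => w.
    by rewrite real_normK ?num_real.
  rewrite -EFin_expe/= exprMn.
  have : M ^+ 2 <= m ^+ 2.
    by rewrite -[M ^+ 2]real_normK ?num_real// lerXn2r ?nnegrE// ltW.
  lra.
have e0 : 0 < m * (y * K - 1) by rewrite mulr_gt0// subr_gt0.
have := markov X e0 (@measurable_id _ R setT) (fun _ r0 => r0)
  (fun _ _ _ _ => id).
have -> : ('E_P[((id \o Num.norm) \o X)%R] = m%:E)%E.
  by rewrite -EX1.
set S := [set x | _]; set S' := [set w | _]; move=> PS.
have mX : measurable_fun [set: T] X by exact: measurable_funPT.
have mS : measurable S.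
  rewrite -[S]setTI; apply: emeasurable_fun_c_infty => //.
  by apply/measurable_EFinP; exact: measurableT_comp.
have mS' : measurable S'.
  rewrite -[S']setTI; apply: measurable_fun_le => //.
  apply: measurableT_comp => //.
  exact: measurable_funB.
apply: (@le_trans _ _ (P S)).
  apply: le_measure; rewrite ?inE// => w; rewrite /S /S'/= lee_fin -/M => Xw.
  have := ler_normB (X w) M; have := ler_wpM2l (ltW y0) V; lra.
have PSE : P S = (fine (P S))%:E by rewrite fineK// fin_num_measure.
move: PS; rewrite PSE -EFinM !lee_fin -mulrA ger_pMr// => PS.
by rewrite -[leRHS]mul1r ler_pdivlMr ?subr_gt0// mulrC.
Qed.

Theorem proposition3p8 (R : realType)
    (d : R -> R -> measure_display)
    (T : forall a s : R, measurableType (d a s))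
    (P : forall a s : R, probability (T a s) R)
    (X : forall a s : R, {RV (P a s) >-> R})
    (hX : forall a s : R, 0 < a -> 0 < s ->
       has_density (X a s) (lognormal_pdf a s))
    (y : R) (hy : 0 < y) :
  ereal_inf [set p : \bar R | exists a s : R, [/\ 0 < a, 0 < s &
    p = P a s [set w | `|X a s w - fine 'E_(P a s)[X a s]|
                         >= y * Num.sqrt (fine 'V_(P a s)[X a s])]]] = 0%E.
Proof.
apply/eqP; rewrite eq_le; apply/andP; split; last first.
  by apply/ereal_infP => _ [a [s [_ _ ->]]]; exact: measure_ge0.
apply/lee_addgt0Pr => e e0; rewrite add0e; apply: ge_ereal_inf.
(* [K] solves [1 / (y * K - 1) = e], and [s] then solves
   [exp (s ^ 2) = 1 + K ^ 2]. *)
pose K := (e^-1 + 1) / y.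
have ei0 : 0 < e^-1 by rewrite invr_gt0.
have K0 : 0 < K by rewrite divr_gt0// addr_gt0.
have yK : y * K = e^-1 + 1 by rewrite mulrCA divff ?mulr1// gt_eqF.
have K1 : 1 < 1 + K ^+ 2 by rewrite ltrDl exprn_gt0.
pose s := Num.sqrt (ln (1 + K ^+ 2)).
have s0 : 0 < s by rewrite sqrtr_gt0 ln_gt0.
have s2 : s ^+ 2 = ln (1 + K ^+ 2) by rewrite sqr_sqrtr// ltW// ln_gt0.
have mass1 k : (\int[lebesgue_measure]_x
    (lognormal_pdf (1 + k%:R * s ^+ 2) s x)%:E = 1)%E.
  apply: (density_integral1 (X := X (1 + k%:R * s ^+ 2) s)).
  apply: hX => //.
  by rewrite ltr_wpDr// mulr_ge0// sqr_ge0.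
have moment k := lognormal_moment s0 (hX 1 s ltr01 s0) (mass1 k).
eexists; first by exists 1, s; split.
pose m : R := expR (1 + s ^+ 2 / 2).
have -> : e = (y * K - 1)^-1 by rewrite yK addrK invrK.
apply: (@prob_deviation_le _ _ _ _ _ m) => //.
- exact: expR_gt0.
- exact: ltW.
- by rewrite yK ltrDr.
- by apply: etrans (moment 1%N) _; rewrite mul1r expr1n mul1r.
- have -> : 1 + K ^+ 2 = expR (s ^+ 2) by rewrite s2 lnK// posrE; lra.
  by rewrite moment -expRM_natl -expRD; congr (expR _)%:E; field.
Qed.
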